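(* In the space $\mathbb{R}^\omega$ endowed with the pointwise topology, the sets $\mathrm{L}(\mathfrak{c})$, $\mathrm{L}(\omega)$, and $\bigcup_{2\leq n<\omega}\mathrm{L}(n)$ are densely lineable in $\mathbb{R}^\omega$, and $\mathrm{L}(\mathfrak{c})$ is spaceable in $\mathbb{R}^\omega$.
   Context: $\mathbb{R}^\omega$ is the real vector space of all real sequences $x=(x(n))_{n\in\omega}$, $\omega=\{0,1,2,\dots\}$ (also denoting the smallest infinite cardinal), endowed with the pointwise (product) topology; $\mathfrak{c}$ is the cardinality of the continuum. For $x\in\mathbb{R}^\omega$, $\mathrm{L}_x\subseteq\mathbb{R}\cup\{\pm\infty\}$ is the set of accumulation points of $x$: a real $\eta$ is in $\mathrm{L}_x$ if $\{n\in\omega:|x(n)-\eta|<\varepsilon\}$ is infinite for all $\varepsilon>0$, and $+\infty$ (resp. $-\infty$) is in $\mathrm{L}_x$ if some subsequence of $x$ diverges to $+\infty$ (resp. $-\infty$). For a cardinal $\kappa$, $\mathrm{L}(\kappa)=\{x\in\mathbb{R}^\omega: |\mathrm{L}_x|=\kappa\}$. A subset $M$ of a topological vector space $X$ is densely lineable in $X$ if $M\cup\{0\}$ contains a linear subspace that is dense in $X$; it is spaceable in $X$ if $M\cup\{0\}$ contains a closed infinite-dimensional linear subspace of $X$. *)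

(* Defs.v *)
From HB Require Import structures.
From mathcomp Require Import all_boot all_order all_algebra.
From mathcomp Require Import all_classical all_reals topology normedtype sequences.

Set Implicit Arguments.
Unset Strict Implicit.
Unset Printing Implicit Defensive.

Import Order.TTheory GRing.Theory Num.Theory.
Import numFieldNormedType.Exports.

Local Open Scope classical_set_scope.
Local Open Scope card_scope.
Local Open Scope ring_scope.

(* [R^o] is [R] as a module over itself, whence the pointwise linear structure. *)
Definition realseq (R : realType) : Type := {ptws nat -> R^o}.

HB.instance Definition _ (R : realType) :=
  Topological.copy (realseq R) {ptws nat -> R^o}.
HB.instance Definition _ (R : realType) :=
  GRing.Lmodule.copy (realseq R) (nat -> R^o).

Section realseq_tvs.
Variable R : realType.

Lemma realseq_cvgP (T : Type) (F : set_system T) (f : T -> realseq R)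
    (l : realseq R) : Filter F ->
  (forall n, (fun t => f t n : R^o) @ F --> (l n : R^o)) -> f @ F --> l.
Proof.
move=> FF H; have [_] := @pointwise_cvgP nat R^o (f @ F) l _.
by apply=> n; exact: H.
Qed.

Lemma realseq_ev (x : realseq R) n :
  (fun y : realseq R => y n : R^o) @ x --> (x n : R^o).
Proof.
have [H _] := @pointwise_cvgP nat R^o (nbhs x) x _.
by apply: H.
Qed.

Lemma realseq_add_continuous :
  continuous (fun z : realseq R * realseq R => z.1 + z.2).
Proof.
move=> z.
apply: (@realseq_cvgP (realseq R * realseq R)%type (nbhs z) (fun u => u.1 + u.2)
  (z.1 + z.2) _) => n.
have H1 : (fun z : realseq R * realseq R => z.1 n : R^o) @ z --> (z.1 n : R^o).
  by apply: (cvg_comp _ _ _ (@realseq_ev z.1 n)); exact: cvg_fst.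
have H2 : (fun z : realseq R * realseq R => z.2 n : R^o) @ z --> (z.2 n : R^o).
  by apply: (cvg_comp _ _ _ (@realseq_ev z.2 n)); exact: cvg_snd.
exact: cvgD H1 H2.
Qed.

Lemma realseq_scale_continuous :
  continuous (fun z : R^o * realseq R => z.1 *: z.2).
Proof.
move=> z.
apply: (@realseq_cvgP (R^o * realseq R)%type (nbhs z) (fun u => u.1 *: u.2)
  (z.1 *: z.2) _) => n.
have H1 : (fun z : R^o * realseq R => z.1) @ z --> (z.1 : R^o).
  exact: cvg_fst.
have H2 : (fun z : R^o * realseq R => z.2 n : R^o) @ z --> (z.2 n : R^o).
  by apply: (cvg_comp _ _ _ (@realseq_ev z.2 n)); exact: cvg_snd.
exact: cvgZ H1 H2.
Qed.

HB.instance Definition _ :=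
  PreTopologicalNmodule_isTopologicalNmodule.Build (realseq R)
    realseq_add_continuous.
HB.instance Definition _ :=
  TopologicalNmodule_isTopologicalLmodule.Build R (realseq R)
    realseq_scale_continuous.

End realseq_tvs.

Section lineability.
Variables (R : realType) (X : topologicalLmodType R).

Definition finite_dimensional (V : set X) : Prop :=
  exists (n : nat) (e : 'I_n -> X),
    V = [set \sum_i c i *: e i | c in [set: 'I_n -> R]].

Definition densely_lineable (M : set X) : Prop :=
  exists V : set X,
    [/\ submod_closed [in V], dense V & V `<=` M `|` [set 0]].

Definition spaceable (M : set X) : Prop :=
  exists V : set X,
    [/\ submod_closed [in V], closed V, ~ finite_dimensional V
      & V `<=` M `|` [set 0]].

End lineability.

Section accumulation.
Variable R : realType.

Definition accumulation_points (x : nat -> R) : set (\bar R) :=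
  [set l : \bar R | match l with
   | EFin eta => forall eps : R, 0 < eps ->
       infinite_set [set n : nat | `|x n - eta| < eps]
   | +oo%E => exists k : nat -> nat,
       increasing_seq k /\ x (k n) @[n --> \oo] --> +oo
   | -oo%E => exists k : nat -> nat,
       increasing_seq k /\ x (k n) @[n --> \oo] --> -oo
   end].

(* A cardinal is represented by any set [K] of that cardinality. *)
Definition Lcard (T : Type) (K : set T) : set (realseq R) :=
  [set x : realseq R | accumulation_points x #= K].

End accumulation.

Arguments Lcard R {T} K.

(* Main.v *)
Require Import Defs.
From mathcomp Require Import all_boot all_order all_algebra.
From mathcomp Require Import all_classical all_reals topology normedtype sequences.
From mathcomp Require Import polyrcf ereal derive lra.

Set Implicit Arguments.
Unset Strict Implicit.
Unset Printing Implicit Defensive.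

Import Order.TTheory GRing.Theory Num.Theory.
Import numFieldNormedType.Exports.

Local Open Scope classical_set_scope.
Local Open Scope card_scope.
Local Open Scope ring_scope.

(** If [y] is an injective sequence of nonzero reals, the sequences [p o y], with
    [p] a polynomial such that [p(0) = 0], form a subspace which is dense by
    Lagrange interpolation, and every nonzero member has [p] nonconstant. The
    accumulation points of [p o y] include the images by [p] of those of [y];
    for [y >= 0] these are all the finite ones, since [p] is proper. It remains
    to choose [y]: an enumeration of the nonzero rationals for the continuum, a
    sequence accumulating exactly at the naturals (and infinity) for [omega],
    and one accumulating exactly at [0] and infinity for the finite case, where
    [p o y] accumulates at [0] and at an infinite value.

    For spaceability, split [nat] into infinitely many infinite blocks and take
    the sequences whose restriction to each block is a multiple of one fixed
    sequence accumulating at every real number. *)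

(** * Infinite sets of indices *)

Lemma infinite_set_inj (T U : Type) (h : T -> U) (A : set T) (B : set U) :
  injective h -> infinite_set A -> (forall t, A t -> B (h t)) -> infinite_set B.
Proof.
move=> hinj Ainf hAB Bfin; apply: Ainf.
apply: (@sub_finite_set _ _ (h @^-1` B)) => //.
by apply: finite_preimage => // s t _ _; exact: hinj.
Qed.

Lemma infinite_set_ge (M : nat) : infinite_set [set m | (M <= m)%N].
Proof.
apply: (@infinite_set_inj _ _ (addn M) setT); first exact: addnI.
  exact: infinite_nat.
by move=> m _ /=; exact: leq_addr.
Qed.

(** * Accumulation points under polynomial maps *)

Section accumulation_points.
Variable R : realType.
Implicit Types (y : nat -> R) (p : {poly R}).

Lemma accumulation_points_subseq y (h : nat -> nat) (a : R) : injective h ->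
  accumulation_points (y \o h) a%:E -> accumulation_points y a%:E.
Proof.
by move=> hinj ya e e0; apply: (infinite_set_inj hinj (ya e e0)).
Qed.

Lemma accumulation_points_horner y p (a : R) :
  accumulation_points y a%:E ->
  accumulation_points (fun n => p.[y n]) p.[a]%:E.
Proof.
move=> ya e e0.
have /(_ (ball p.[a] e)) : {for a, continuous (horner p)} by exact: continuous_horner.
move=> /(_ (nbhsx_ballx _ _ e0)) [d /= d0 dP].
apply: sub_infinite_set (ya d d0) => n /= nd.
rewrite distrC; apply: dP => /=.
by rewrite distrC.
Qed.

Lemma horner_norm_ge p (C : R) : (1 < size p)%N ->
  exists N, forall x, N <= x -> C <= `|p.[x]|.
Proof.
move=> p1; have p0 : lead_coef p != 0.
  by rewrite lead_coef_eq0 -size_poly_gt0 ltnW.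
have [pn|pp] : lead_coef p < 0 \/ 0 < lead_coef p by apply/orP; rewrite -neq_lt.
  have [||N HN] := @poly_lim_infty _ (- p) C.
  - by rewrite lead_coefN oppr_gt0.
  - by rewrite size_polyN.
  exists N => x /HN; rewrite hornerN => /le_trans; apply.
  by rewrite -normrN ler_norm.
have [N HN] := @poly_lim_infty _ p C pp p1.
by exists N => x /HN /le_trans; apply; exact: ler_norm.
Qed.

(** Along the indices where [p.[y n]] is close to [eta], properness of [p] and [0 <= y n] confine
    [y] to a compact interval. A cluster point there is sent to [eta] by continuity. *)
Lemma accumulation_points_horner_inv y p (eta : R) :
  (forall n, 0 <= y n) -> (1 < size p)%N ->
  accumulation_points (fun n => p.[y n]) eta%:E ->
  exists2 a, accumulation_points y a%:E & p.[a] = eta.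
Proof.
move=> y0 p1 peta.
have [N HN] := horner_norm_ge (`|eta| + 1) p1.
(* [G] collects the sets that miss only finitely many of the indices with [p.[y n]] within some [e]
   of [eta]; it is proper because [eta] is an accumulation point. *)
pose G : set_system nat := [set S | exists2 e : R, 0 < e &
  finite_set [set n | `|p.[y n] - eta| < e /\ ~ S n]].
have GF : ProperFilter G.
  apply: Build_ProperFilter_ex => [S [e e0 Sfin]|].
    apply: contrapT => S0; apply: (peta e e0); apply: sub_finite_set Sfin => n /= ne.
    by split=> // Sn; apply: S0; exists n.
  split.
  - by exists 1 => //; apply: sub_finite_set (@finite_set0 nat) => n [_]; apply.
  - move=> S T [e e0 Sfin] [d d0 Tfin]; exists (Num.min e d).
      by rewrite lt_min e0.
    have : finite_set ([set n | `|p.[y n] - eta| < e /\ ~ S n] `|`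
                       [set n | `|p.[y n] - eta| < d /\ ~ T n]).
      by rewrite finite_setU; split.
    apply: sub_finite_set => n /= []; rewrite lt_min => /andP[ne nd] nST.
    have [Sn|nS] := pselect (S n); last by left.
    by right; split=> // Tn; apply: nST.
  - move=> S T ST [e e0 Sfin]; exists e => //.
    by apply: sub_finite_set Sfin => n /= [? nT]; split=> // /ST.
have GN : (y @ G) `[0, N]%classic.
  exists 1 => //; apply: sub_finite_set (@finite_set0 nat) => n /= [ne]; apply.
  rewrite in_itv /= y0 /= leNgt; apply/negP => /ltW /HN.
  by have := ler_dist_dist p.[y n] eta; have := ler_norm (`|p.[y n]| - `|eta|); lra.
have [a [_ acl]] := @segment_compact R 0 N (y @ G) _ GN.
exists a.
  move=> e e0 fin.
  have [||x [ax /=]] := acl (~` ball a e) (ball a e); last by move=> /ax.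
    exists 1 => //; apply: sub_finite_set fin => n /= [_].
    by move=> /contrapT; rewrite /ball /= distrC.
  exact: nbhsx_ballx.
apply/eqP/negPn/negP => pa.
pose d := `|p.[a] - eta| / 2.
have d0 : 0 < d by rewrite divr_gt0// normr_gt0 subr_eq0.
have pc : {for a, continuous (horner p)} by exact: continuous_horner.
have [||x [/= xe xp]] := acl [set x | `|p.[x] - eta| < d] (horner p @^-1` ball p.[a] d).
- by exists d => //; apply: sub_finite_set (@finite_set0 nat) => n /= [].
- exact: pc (nbhsx_ballx _ _ d0).
move: xp; rewrite /ball /= => xp.
have := ler_distD p.[x] p.[a] eta.
by rewrite /d in xe xp *; lra.
Qed.
End accumulation_points.

(** * Interpolation and density *)

Lemma horner_interpolation (R : fieldType) (y x : nat -> R) (N : nat) :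
  injective y -> (forall n, y n != 0) ->
  exists2 p : {poly R}, p.[0] = 0 & forall n, (n < N)%N -> p.[y n] = x n.
Proof.
move=> yinj y0; elim: N => [|N [p p0 pN]]; first by exists 0; rewrite ?horner0.
(* Newton's correction term: [q] vanishes at [0] and at the earlier nodes, but not at [y N]. *)
pose q : {poly R} := 'X * \prod_(i < N) ('X - (y i)%:P).
have qN : q.[y N] != 0.
  rewrite hornerM hornerX mulf_neq0// horner_prod; apply/prodf_neq0 => i _.
  rewrite hornerXsubC subr_eq0; apply/eqP => /yinj Ni.
  by have := ltn_ord i; rewrite -Ni ltnn.
have q0 : q.[0] = 0 by rewrite hornerM hornerX mul0r.
exists (p + ((x N - p.[y N]) / q.[y N]) *: q).
  by rewrite hornerD p0 hornerZ q0 mulr0 addr0.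
move=> n; rewrite ltnS leq_eqVlt => /predU1P[->|nN]; rewrite hornerD hornerZ.
  by rewrite divfK// addrC subrK.
have -> : q.[y n] = 0; last by rewrite mulr0 addr0 pN.
by rewrite hornerM horner_prod (bigD1 (Ordinal nN))//= hornerXsubC subrr mul0r mulr0.
Qed.

Lemma densely_lineable_horner (R : realType) (M : set (realseq R)) (y : nat -> R) :
  injective y -> (forall n, y n != 0) ->
  (forall p : {poly R}, (1 < size p)%N -> p.[0] = 0 ->
     M (fun n => p.[y n] : R^o)) ->
  densely_lineable M.
Proof.
move=> yinj y0 HM.
exists [set x : realseq R | exists2 p : {poly R}, p.[0] = 0 &
  x = (fun n => p.[y n] : R^o)]; split.
- split=> [|a u v].
    by rewrite inE; exists 0; rewrite ?horner0//; apply/funext => n; rewrite horner0.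
  rewrite !inE => -[p p0 ->] [q q0 ->]; exists (a *: p + q).
    by rewrite hornerD hornerZ p0 q0 mulr0 addr0.
  by apply/funext => n; rewrite hornerD hornerZ.
- move=> O [x Ox] oO.
  pose P N p := p.[0] = 0 /\ forall n, (n < N)%N -> p.[y n] = x n.
  have /choice[p pP] : forall N, exists p, P N p.
    by move=> N; have [p] := horner_interpolation x N yinj y0; exists p.
  (* [v N] agrees with [x] on the first [N] coordinates, so each coordinate is eventually constant
     and [v] converges pointwise to [x]. *)
  pose v N : realseq R := fun n => (p N).[y n] : R^o.
  have vx : v @ \oo --> x.
    apply: realseq_cvgP => n; apply: cvg_near_cst.
    by exists n.+1 => // N /= nN; exact: (pP N).2.
  have [N _ /(_ N (leqnn N)) ON] : \forall N \near \oo, O (v N).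
    by apply: vx; exact: open_nbhs_nbhs.
  by exists (v N); split=> //; exists (p N) => //; exact: (pP N).1.
- move=> x [p p0 ->]; have [p1|p1] := leqP (size p) 1; last by left; exact: HM.
  right; move: p0; rewrite (size1_polyC p1) hornerC => ->.
  by apply/funext => n; rewrite hornerC.
Qed.

(** * Sequences with continuum many accumulation points *)

Section cardinality.
Variable R : realType.

(** Two injections suffice: [contract] embeds the extended reals into the reals, and [f] places a
    copy of the reals among the accumulation points. *)
Lemma Lcard_setT (x : realseq R) (f : R -> R) : injective f ->
  (forall t, accumulation_points x (f t)%:E) -> Lcard R [set: R] x.
Proof.
move=> finj xf; rewrite /Lcard /= card_eq_le; apply/andP; split.
  apply/pcard_leP/injfunPex; exists (@contract R) => // s t _ _.
  exact: contract_inj.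
apply/pcard_leP/injfunPex; exists (fun t => (f t)%:E) => [t _|s t _ _ []]; first exact: xf.
exact: finj.
Qed.

(* A nonconstant [p] with [p.[0] = 0] takes every nonnegative or every
   nonpositive value, and [1 + contract] embeds the reals in [[0, 2]]. *)
Lemma injective_horner (p : {poly R}) : (1 < size p)%N -> p.[0] = 0 ->
  exists g : R -> R, injective (fun t => p.[g t]).
Proof.
move=> p1 p0; have [N HN] := horner_norm_ge 2 p1.
pose b := Num.max 0 N.
have b0 : 0 <= b by rewrite le_max lexx.
have pb : 2 <= `|p.[b]| by apply: HN; rewrite le_max lexx orbT.
pose c t := 1 + contract (t%:E : \bar R).
have c02 t : 0 <= c t <= 2.
  by have := contract_le1 (t%:E : \bar R); rewrite ler_norml /c; lra.
have pq t : {u | p.[u] = Num.sg p.[b] * c t}.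
  have [|u _ /rootP] := @polyrcf.poly_ivt R (p - (Num.sg p.[b] * c t)%:P) 0 b b0.
    rewrite !hornerD !hornerN !hornerC p0 sub0r.
    move: pb (c02 t); set s := c t; case: (sgrP p.[b]) => [_|bp|bp]; nra.
  by rewrite hornerD hornerN hornerC => /subr0_eq <-; exists u.
exists (fun t => sval (pq t)) => s t.
rewrite (svalP (pq s)) (svalP (pq t)) => /mulfI.
have pb0 : p.[b] != 0 by rewrite -normr_eq0; apply/eqP => pb0; move: pb; rewrite pb0; lra.
rewrite sgr_eq0 => /(_ pb0) /addrI /contract_inj [].
by [].
Qed.
End cardinality.

(** * The three base sequences *)

Section sequences.
Variable R : realType.

Lemma exists_dense_sequence : exists y : nat -> R,
  [/\ injective y, forall n, y n != 0 & forall a, accumulation_points y a%:E].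
Proof.
have /card_set_bijP [q [q0 qinj qsurj]] : [set: nat] #= [set r : rat | r != 0].
  rewrite card_eq_sym; apply: eq_card_nat; first exact: countableP.
  have -> : [set r : rat | r != 0] = setT `\` [set 0].
    by apply/seteqP; split=> r /=; [move=> /eqP r0; split|move=> [_ /eqP]].
  by apply: infinite_setD; [exact: infinite_rat|exact: finite_set1].
pose y n : R := ratr (q n).
exists y; split.
- by move=> m n /fmorph_inj /qinj; apply; exact: mem_set.
- by move=> n; rewrite fmorph_eq0; exact: q0.
move=> a e e0.
have lim : limit_point ([set ratr r | r in [set r : rat | r != 0]] : set R) a.
  move=> U /nbhs_ballP [d /= d0 dU].
  have d0' : 0 < d by exact: d0.
  (* For negative [a] the endpoint [b] is capped at [0], so that a rational in the open interval
     from [a] to [b] is never zero. *)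
  have [b ab [bd b0]] : exists2 b, a < b & b <= a + d /\ (a < 0 -> b <= 0).
    have [a0|a0] := leP 0 a.
      by exists (a + d); [lra|split=> //; rewrite ltNge a0].
    exists (Num.min (a + d) 0); first by rewrite lt_min a0; lra.
    by rewrite !ge_min !lexx orbT.
  have [r] := rat_in_itvoo ab; rewrite in_itv /= => /andP[ar rb].
  exists (ratr r); split; first by rewrite gt_eqF.
    exists r => //=; apply/eqP => r0; move: ar rb; rewrite r0 rmorph0 => a0.
    by rewrite ltNge b0.
  by apply: dU; rewrite /ball /= ltr_distl; lra.
move=> fin; apply: (limit_point_infinite_setP _ _).1 lim _ (nbhsx_ballx a e e0) _.
apply: (sub_finite_set _ (finite_image y fin)) => x [/= xa [r r0 rx]].
have [n _ qn] := qsurj r r0; exists n; rewrite /y qn// rx distrC.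
exact: xa.
Qed.

Lemma exists_nat_limit_sequence : exists y : nat -> R,
  [/\ injective y, forall n, 0 < y n, forall k : nat, accumulation_points y k%:R%:E &
      forall a, accumulation_points y a%:E -> exists k : nat, a = k%:R].
Proof.
have /card_set_bijP [f] : [set: nat] #= [set: nat * nat].
  by rewrite card_eq_sym; exact: card_nat2.
rewrite setTT_bijective => -[g fK gK].
(* The denominator starts at 2 so that [z (k, j)] lies strictly between [k] and [k + 1], whence
   truncation recovers [k]. *)
pose z (u : nat * nat) : R := u.1%:R + u.2.+2%:R^-1.
have z_itv u : u.1%:R < z u < u.1%:R + 1.
  by rewrite /z ltrDl invr_gt0 ltr0n ltrD2l invf_lt1 ?ltr1n ?ltr0n.
have z_trunc u : Num.truncn (z u) = u.1.
  by apply: truncn_def; rewrite -natr1; have /andP[/ltW -> ->] := z_itv u.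
have zinj : injective z.
  move=> [k j] [k' j'] zz; have := congr1 Num.truncn zz; rewrite !z_trunc /= => kk.
  move: zz; rewrite /z /= kk => /addrI /invr_inj /eqP.
  by rewrite eqr_nat => /eqP [->].
exists (z \o f); split.
- by move=> m n /zinj /(can_inj fK).
- by move=> n; apply: le_lt_trans (ler0n _ (f n).1) _; have /andP[] := z_itv (f n).
- move=> k e e0.
  apply: (@infinite_set_inj _ _ (fun j => g (k, j)) [set j | (Num.truncn e^-1 <= j)%N]).
  + by move=> i j /(can_inj gK) [].
  + exact: infinite_set_ge.
  + move=> j /= ej; rewrite gK /z /= addrC addKr gtr0_norm ?invr_gt0//.
    rewrite invf_plt ?posrE//; apply: lt_le_trans (truncnS_gt _) _.
    by rewrite ler_nat ltnS ltnW// ltnS.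
move=> a ya.
have fin_box K J : finite_set [set n | ((f n).1 < K)%N /\ ((f n).2 < J)%N].
  apply: (sub_finite_set _ (finite_image g (finite_setX (finite_II K) (finite_II J)))).
  by move=> n /= [? ?]; exists (f n).
have a0 : 0 <= a.
  rewrite leNgt; apply/negP => a0.
  apply: (ya (- a)); first by rewrite oppr_gt0.
  apply: (sub_finite_set _ (@finite_set0 _)) => n /=.
  rewrite ltr_distl subrr => /andP[_].
  have /andP[+ _] := z_itv (f n); have := ler0n R (f n).1.
  lra.
exists (Num.truncn a); apply/eqP/negPn/negP => ne.
have /andP[a1 a2] := truncn_itv a0.
set m := Num.truncn a in ne a1 a2 *.
rewrite -natr1 in a2.
have am : m%:R < a by rewrite lt_neqAle eq_sym ne.
(* Half the distance from [a] to the nearer of [m] and [m + 1]. A term [z (k, j)] within [e] of [a]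
   then has [k <= m] and fractional part above [e], which bounds [j]: finitely many terms remain. *)
pose e := Num.min (a - m%:R) (m%:R + 1 - a) / 2.
have e0 : 0 < e by rewrite divr_gt0// lt_min !subr_gt0 am a2.
have [ea1 ea2] : e <= (a - m%:R) / 2 /\ e <= (m%:R + 1 - a) / 2.
  by rewrite /e !ler_pM2r ?invr_gt0// !ge_min !lexx orbT.
apply: (ya e e0).
apply: (sub_finite_set _ (fin_box m.+1 (Num.truncn e^-1))) => n /=.
rewrite ltr_distl => /andP[n1 n2].
have /andP[n3 n4] := z_itv (f n).
have km : ((f n).1 < m.+1)%N.
  rewrite ltnNge; apply/negP; rewrite -(ler_nat R) -natr1 => mk.
  lra.
split=> //.
have : (f n).1%:R <= m%:R :> R by rewrite ler_nat.
move=> km'.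
have : e < (f n).2.+2%:R^-1 by move: n1; rewrite /= /z; set t := _^-1; lra.
rewrite invf_pgt ?posrE ?ltr0n// => je.
have : (f n).2.+1%:R <= e^-1 by move: je; rewrite -natr1; lra.
rewrite -ltnS -truncn_ge_nat ?invr_ge0 ?ltW//.
Qed.

Lemma exists_null_divergent_sequence : exists y : nat -> R,
  [/\ injective y, forall n, 0 < y n, accumulation_points y 0%:E,
      forall a, accumulation_points y a%:E -> a = 0 &
      exists2 k : nat -> nat, increasing_seq k & forall n, n%:R <= y (k n)].
Proof.
(* Odd terms exceed 1 and diverge, even terms are at most 1 and tend to 0; the threshold 1 separates
   the two parities for injectivity. *)
pose y n : R := if odd n then n.+1%:R else n.+1%:R^-1.
have y1 n : odd n -> 1 < y n by rewrite /y => on; rewrite on ltr1n ltnS odd_gt0.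
have y2 n : ~~ odd n -> y n <= 1.
  by rewrite /y => /negPf ->; rewrite invf_le1 ?ler1n ?ltr0n.
exists y; split.
- move=> m n.
  have [om|om] := boolP (odd m); have [on|on] := boolP (odd n).
  + by rewrite /y om on => /eqP; rewrite eqr_nat => /eqP [].
  + by move=> mn; have := y1 _ om; rewrite mn ltNge y2.
  + by move=> mn; have := y1 _ on; rewrite -mn ltNge y2.
  + by rewrite /y (negPf om) (negPf on) => /invr_inj /eqP; rewrite eqr_nat => /eqP [].
- by move=> n; rewrite /y; case: ifP; rewrite ?invr_gt0.
- move=> e e0.
  apply: (@infinite_set_inj _ _ double [set m | (Num.truncn e^-1 <= m)%N]).
  + exact: double_inj.
  + exact: infinite_set_ge.
  + move=> m /= em; rewrite /y odd_double subr0 gtr0_norm ?invr_gt0//.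
    rewrite invf_plt ?posrE//; apply: lt_le_trans (truncnS_gt _) _.
    by rewrite ler_nat ltnS (leq_trans em)// -addnn leq_addr.
- move=> a ya; apply/eqP/negPn/negP => a0.
  have e0 : 0 < `|a| / 2 by rewrite divr_gt0 ?normr_gt0.
  apply: (ya _ e0).
  (* From [N] on, odd terms are at least [2|a|] and even terms at most [|a|/2], so none is within
     [|a|/2] of [a]. *)
  pose N := maxn (Num.truncn (`|a| * 2)).+1 (Num.truncn (`|a| / 2)^-1).+1.
  apply: (sub_finite_set _ (finite_II N)) => n /= ne.
  rewrite ltnNge; apply/negP; rewrite geq_max => /andP[n1 n2].
  have yn : `|a| / 2 < `|y n| < `|a| * 2.
    by have := ler_dist_dist (y n) a; have := ler_norm (`|y n| - `|a|);
       have := ler_norm (`|a| - `|y n|); rewrite (distrC `|a|); lra.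
  have [on|on] := boolP (odd n); move: yn; rewrite /y ?on ?(negPf on) => /andP[yn1 yn2].
    move: yn2; rewrite normr_nat ltNge => /negP; apply.
    apply: ltW; apply: lt_le_trans (truncnS_gt _) _.
    by rewrite ler_nat ltnW// ltnS.
  move: yn1; rewrite normfV normr_nat ltNge => /negP; apply.
  rewrite invf_ple ?posrE ?ltr0n//.
  apply: ltW; apply: lt_le_trans (truncnS_gt _) _.
  by rewrite ler_nat ltnW// ltnS.
- exists (fun n => n.*2.+1); first by move=> m n /=; rewrite !leEnat ltnS leq_double.
  by move=> n; rewrite /y /= odd_double /= ler_nat -addnn -addnS -addnS leq_addr.
Qed.
End sequences.

(** * Dense lineability and spaceability *)

Section lineability.
Variable R : realType.

Lemma densely_lineable_Lcard_continuum : densely_lineable (Lcard R [set: R]).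
Proof.
have [y [yinj y0 ydense]] := exists_dense_sequence R.
apply: (densely_lineable_horner yinj y0) => p p1 p0.
have [g ginj] := injective_horner p1 p0.
by apply: (Lcard_setT ginj) => t; exact: accumulation_points_horner.
Qed.

Lemma densely_lineable_Lcard_nat : densely_lineable (Lcard R [set: nat]).
Proof.
have [y [yinj y0 ynat ynat_inv]] := exists_nat_limit_sequence R.
apply: (densely_lineable_horner yinj) => [n|p p1 p0]; first by rewrite gt_eqF.
apply: eq_card_nat.
  (* Countability: every accumulation point is some [p.[k%:R]] or one of the two infinities. *)
  pose G (i : nat + bool) : \bar R :=
    match i with inl k => p.[k%:R]%:E | inr b => if b then +oo%E else -oo%E end.
  apply: (@sub_countable _ _ _ (range G)); last first.
    exact: sub_countable (card_image_le _ _) (countableP _).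
  apply: subset_card_le => -[a|_|_].
  - move=> /(accumulation_points_horner_inv (fun n => ltW (y0 n)) p1) [b /ynat_inv [k ->] <-].
    by exists (inl k).
  - by exists (inr true).
  - by exists (inr false).
(* Infinitude: each value is taken at finitely many naturals since [p] is proper, so [p] takes
   infinitely many values on them. *)
pose F : set R := range (fun k : nat => p.[k%:R]).
move=> fin; have Ffin : finite_set F.
  apply: (sub_finite_set _ (finite_image fine fin)) => _ [k _ <-].
  by exists p.[k%:R]%:E => //; exact: accumulation_points_horner.
apply: infinite_nat.
apply: (@sub_finite_set _ _ (\bigcup_(v in F) [set k : nat | p.[k%:R] = v])).
  by move=> k _; exists p.[k%:R] => //; exists k.
apply: bigcup_finite => // v _.
have [N HN] := horner_norm_ge (`|v| + 1) p1.
apply: (sub_finite_set _ (finite_II (Num.truncn N).+1)) => k /= kv.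
rewrite ltnNge; apply/negP => Nk.
have : `|v| + 1 <= `|v|.
  rewrite -{2}kv; apply: HN; apply: ltW; apply: lt_le_trans (truncnS_gt N) _.
  by rewrite ler_nat.
by lra.
Qed.

Lemma accumulation_points_horner_pinfty (p : {poly R}) (y : nat -> R) (k : nat -> nat) :
  (1 < size p)%N -> 0 < lead_coef p ->
  increasing_seq k -> (forall n, n%:R <= y (k n)) ->
  accumulation_points (fun n => p.[y n]) +oo%E.
Proof.
move=> p1 pp kinc yk; exists k; split=> //; apply/cvgryPge => A.
have [N HN] := poly_lim_infty A pp p1.
exists (Num.truncn N).+1 => // n /= Nn; apply: HN; apply: le_trans (yk n).
by apply: ltW; apply: lt_le_trans (truncnS_gt N) _; rewrite ler_nat.
Qed.

Lemma accumulation_points_opp (x : nat -> R) :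
  accumulation_points (fun n => - x n) +oo%E -> accumulation_points x -oo%E.
Proof.
move=> [k [kinc xk]]; exists k; split=> //.
exact/cvgNry.
Qed.

Lemma densely_lineable_Lcard_finite :
  densely_lineable (\bigcup_(n in [set n : nat | (2 <= n)%N]) Lcard R `I_n).
Proof.
have [y [yinj y0 ynull ynull_inv [k kinc yk]]] := exists_null_divergent_sequence R.
apply: (densely_lineable_horner yinj) => [n|p p1 p0]; first by rewrite gt_eqF.
set L := accumulation_points (fun n => p.[y n]).
have L0 : L 0%:E by rewrite -p0; exact: accumulation_points_horner.
(* The second accumulation point is the infinity whose sign is that of the leading coefficient. *)
have [s [Ls s0]] : exists s : \bar R, L s /\ s != 0%E.
  have : lead_coef p != 0 by rewrite lead_coef_eq0 -size_poly_gt0 ltnW.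
  rewrite neq_lt => /orP[pn|pp]; last first.
    by exists +oo%E; split=> //; exact: accumulation_points_horner_pinfty kinc yk.
  exists -oo%E; split=> //; apply: accumulation_points_opp.
  have -> : (fun n => - p.[y n]) = (fun n => (- p).[y n]).
    by apply/funext => n; rewrite hornerN.
  apply: accumulation_points_horner_pinfty kinc yk; first by rewrite size_polyN.
  by rewrite lead_coefN oppr_gt0.
have /finite_setP [n Ln] : finite_set L.
  apply: (@sub_finite_set _ _ [set 0%E; +oo%E; -oo%E]) => // -[a|_|_].
  - move=> /(accumulation_points_horner_inv (fun n => ltW (y0 n)) p1) [b /ynull_inv -> <-].
    by left; left; rewrite p0.
  - by left; right.
  - by right.
exists n => //=; rewrite -card_le_II -(card_le_eqr Ln).
apply/pcard_leP/injfunPex; exists (fun i => if i is 0%N then 0%E else s).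
  by move=> [|i].
by move=> [|[|i]] [|[|j]]; rewrite !inE//= => _ _ s0'; move: s0; rewrite -?s0' ?s0' eqxx.
Qed.

Lemma realseq_sumE (I : Type) (r : seq I) (F : I -> realseq R) (n : nat) :
  (\sum_(i <- r) F i) n = \sum_(i <- r) F i n.
Proof. by elim: r => [|i r IH]; rewrite ?big_nil// !big_cons -IH. Qed.

Lemma spaceable_Lcard_continuum : spaceable (Lcard R [set: R]).
Proof.
have [y [_ y0 ydense]] := exists_dense_sequence R.
have /card_set_bijP [f] : [set: nat] #= [set: nat * nat].
  by rewrite card_eq_sym; exact: card_nat2.
rewrite setTT_bijective => -[g fK gK].
(* Normalised so that [z 0 = 1]. *)
pose z m := y m / y 0%N.
have z0 : z 0%N = 1 by rewrite /z divff.
(* The blocks are the ranges of [g (k, _)]; the first entry of a block is the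
   multiple of [z] it carries. *)
pose V := [set x : realseq R | forall n, x n = x (g ((f n).1, 0%N)) * z (f n).2].
exists V; split.
- split=> [|a u v]; first by rewrite inE => n; rewrite mul0r.
  rewrite !inE => uV vV n.
  by rewrite /= -[LHS]/(a * u n + v n) uV vV mulrA -mulrDl.
(* [V] is an intersection of kernels of continuous functionals. *)
- have -> : V = \bigcap_n [set x : realseq R |
      x n - x (g ((f n).1, 0%N)) * z (f n).2 = 0].
    apply/seteqP; split=> x /= xV n; first by move=> _ /=; rewrite -xV subrr.
    by apply: subr0_eq; exact: xV.
  apply: closed_bigI => n _.
  pose phi (x : realseq R) : R^o := x n - x (g ((f n).1, 0%N)) * z (f n).2.
  suff /continuous_closedP phi_closed : continuous phi by exact: phi_closed (@closed_eq R 0).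
  move=> x; have xm := @realseq_ev R x (g ((f n).1, 0%N)).
  exact: cvgB (@realseq_ev R x n) (cvgMr_tmp (b := z (f n).2) xm).
- move=> [d [e Ve]].
  (* The first entries of blocks [0] to [d] can be prescribed freely in [V], so [d] generators would
     give a matrix with [d] rows and rank [d + 1]. *)
  pose E : 'M[R]_(d, d.+1) := \matrix_(i, j) e i (g (j : nat, 0%N)).
  have full (u : 'rV[R]_d.+1) : (u <= E)%MS.
    pose x : realseq R := fun n =>
      (if ((f n).1 < d.+1)%N then u ord0 (inord (f n).1) else 0) * z (f n).2 : R^o.
    have : V x by move=> n; rewrite /x !gK /= z0 mulr1.
    rewrite Ve => -[c _ cx]; apply/submxP; exists (\row_i c i).
    apply/rowP => j; rewrite mxE.
    have := congr1 (fun x : realseq R => x (g (j : nat, 0%N))) cx.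
    rewrite /= /x gK /= z0 mulr1 ltn_ord inord_val => <-.
    by rewrite realseq_sumE; apply: eq_bigr => i _; rewrite !mxE.
  have : (1%:M <= E)%MS by apply/row_subP => i; exact: full.
  move=> /mxrankS; rewrite mxrank1 => /leq_trans /(_ (rank_leq_row E)).
  by rewrite ltnn.
move=> x xV; have [x0|/existsNP [n xn]] := pselect (forall n, x n = 0).
  by right; apply/funext => n; rewrite x0.
(* On a block where [x] is not zero, [x] is a nonzero multiple of [y], so it accumulates at every
   real. *)
left; pose k := (f n).1; pose c := x (g (k, 0%N)).
have c0 : c != 0 by apply/eqP => c0; apply: xn; rewrite xV -/k -/c c0 mul0r.
apply: (@Lcard_setT _ _ id) => // t.
apply: (@accumulation_points_subseq _ _ (fun m => g (k, m))).
  by move=> i j /(can_inj gK) [].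
pose p : {poly R} := (c / y 0%N) *: 'X.
have pE s : p.[s] = c / y 0%N * s by rewrite hornerZ hornerX.
have -> : x \o (fun m => g (k, m)) = (fun m => p.[y m]).
  apply/funext => m /=; rewrite xV gK /= -/c pE /z.
  by rewrite mulrA mulrAC.
have -> : t = p.[t / (c / y 0%N)] by rewrite pE mulrC divfK// mulf_neq0 ?invr_eq0.
exact: accumulation_points_horner.
Qed.
End lineability.

Theorem mainTheorem11 (R : realType) :
  [/\ densely_lineable (Lcard R [set: R]),
      densely_lineable (Lcard R [set: nat]),
      densely_lineable (\bigcup_(n in [set n : nat | (2 <= n)%N]) Lcard R `I_n)
    & spaceable (Lcard R [set: R])].
Proof.
split.
- exact: densely_lineable_Lcard_continuum.
- exact: densely_lineable_Lcard_nat.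
- exact: densely_lineable_Lcard_finite.
- exact: spaceable_Lcard_continuum.
Qed.
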